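(* Let $\mathbb{D}\in\{\mathbb{R},\mathbb{C},\mathbb{H}\}$, let $f:(0,\infty)\to(0,\infty)$ be a continuous function with $f(1)=1$, and let $\hat{\sigma}_f$ be the alternative mean associated with $f$. Let $A,B\in\mathscr{P}_n(\mathbb{D})$ be such that $AB=BA$, let $r=|\mathrm{Spec}(A^{-1}B)|$, and write $\mathrm{Spec}(A^{-1}B)=\{\lambda_1,\dots,\lambda_r\}$. Then $$f\big((A^{-1}B)^{1/2}\big)=\sum_{i=0}^{r-1}d_i\,(A^{-1}B)^{i/2},$$ where $$d_k=(-1)^{r-1-k}\sum_{i=1}^{r}f(\sqrt{\lambda_i})\,\frac{e_{r-1-k}(\widehat{\sqrt{\lambda_i}})}{\prod_{j\neq i}(\sqrt{\lambda_i}-\sqrt{\lambda_j})},\qquad 0\leq k\leq r-1.$$ Moreover, $$A\,\hat{\sigma}_f\,B=\sum_{i=0}^{r-1}\sum_{j=0}^{r-1}d_id_j\,A\,(A^{-1}B)^{\frac{i+j}{2}}.$$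
   Context: $\mathscr{P}_n(\mathbb{D})$ is the set of $n\times n$ matrices $A$ over $\mathbb{D}$ that are Hermitian ($A=A^*$, with $A^*$ the conjugate transpose) and positive ($x^*Ax>0$ for all nonzero $x\in\mathbb{D}^n$). $\mathrm{Spec}(X)$ is the set of eigenvalues of $X$ (right eigenvalues when $\mathbb{D}=\mathbb{H}$), without multiplicity. For a continuous $f:(0,\infty)\to\mathbb{R}$ and $X=U\,\mathrm{diag}(\lambda_1,\dots,\lambda_n)\,U^*\in\mathscr{P}_n(\mathbb{D})$ with $UU^*=\mathrm{Id}_n$, set $f(X)=U\,\mathrm{diag}(f(\lambda_1),\dots,f(\lambda_n))\,U^*$; real powers $X^s$ are defined this way. When $AB=BA$, the matrix $A^{-1}B$ belongs to $\mathscr{P}_n(\mathbb{D})$. The geometric mean is $A\sharp B=A^{1/2}(A^{-1/2}BA^{-1/2})^{1/2}A^{1/2}$. The alternative mean associated with $f$ is the operation $\hat{\sigma}_f:\mathscr{P}_n(\mathbb{D})\times\mathscr{P}_n(\mathbb{D})\to\mathscr{P}_n(\mathbb{D})$ given by $A\,\hat{\sigma}_f\,B=f(A^{-1}\sharp B)\,A\,f(A^{-1}\sharp B)$. $\widehat{\sqrt{\lambda_i}}\in\mathbb{R}^{r-1}$ is the vector $(\sqrt{\lambda_1},\dots,\sqrt{\lambda_r})$ with the entry $\sqrt{\lambda_i}$ removed, and $e_m$ is the elementary symmetric polynomial of degree $m$ in $r-1$ variables, with $e_0=1$. *)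

(* Defs.v *)
From HB Require Import structures.
From mathcomp Require Import all_boot all_order all_algebra.
From mathcomp Require Import complex ring.
From mathcomp Require Import all_classical all_reals all_analysis.
(* mpoly is not imported: its notations clash with those of analysis. *)
From mathcomp Require mpoly.

Set Implicit Arguments.
Unset Strict Implicit.
Unset Printing Implicit Defensive.

Import Order.TTheory GRing.Theory Num.Theory.
Import numFieldNormedType.Exports.

Local Open Scope classical_set_scope.
Local Open Scope ring_scope.

(* [Quat a b c d] is a + b i + c j + d k. *)
Record quat (R : Type) : Type := Quat { qre : R; qi : R; qj : R; qk : R }.

Section QuatChoice.
Variable R : Type.

Definition prod_of_quat (x : quat R) : R * R * R * R :=
  (qre x, qi x, qj x, qk x).
Definition quat_of_prod (t : R * R * R * R) : quat R :=
  let: (a, b, c, d) := t in Quat a b c d.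

Lemma prod_of_quatK : cancel prod_of_quat quat_of_prod.
Proof. by case. Qed.

End QuatChoice.

HB.instance Definition _ (R : choiceType) :=
  Choice.copy (quat R) (can_type (@prod_of_quatK R)).

Section QuatRing.
Variable R : comNzRingType.
Implicit Types x y z : quat R.

Definition realq (a : R) : quat R := Quat a 0 0 0.

Definition addq x y : quat R :=
  Quat (qre x + qre y) (qi x + qi y) (qj x + qj y) (qk x + qk y).

Definition oppq x : quat R := Quat (- qre x) (- qi x) (- qj x) (- qk x).

(* The Hamilton product: i^2 = j^2 = k^2 = ijk = -1. *)
Definition mulq x y : quat R :=
  Quat (qre x * qre y - qi x * qi y - qj x * qj y - qk x * qk y)
       (qre x * qi y + qi x * qre y + qj x * qk y - qk x * qj y)
       (qre x * qj y - qi x * qk y + qj x * qre y + qk x * qi y)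
       (qre x * qk y + qi x * qj y - qj x * qi y + qk x * qre y).

Definition conjq x : quat R := Quat (qre x) (- qi x) (- qj x) (- qk x).

Lemma addqA : associative addq.
Proof. by move=> [????] [????] [????]; rewrite /addq /= !addrA. Qed.

Lemma addqC : commutative addq.
Proof. by move=> [????] [????]; congr Quat; rewrite /= addrC. Qed.

Lemma add0q : left_id (realq 0) addq.
Proof. by move=> [????]; rewrite /addq /= !add0r. Qed.

Lemma addNq : left_inverse (realq 0) oppq addq.
Proof. by move=> [????]; rewrite /addq /= !addNr. Qed.

HB.instance Definition _ :=
  GRing.isZmodule.Build (quat R) addqA addqC add0q addNq.

Lemma mulqA : associative mulq.
Proof. by move=> [????] [????] [????]; congr Quat => /=; ring. Qed.

Lemma mul1q : left_id (realq 1) mulq.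
Proof. by move=> [????]; congr Quat => /=; ring. Qed.

Lemma mulq1 : right_id (realq 1) mulq.
Proof. by move=> [????]; congr Quat => /=; ring. Qed.

Lemma mulqDl : left_distributive mulq addq.
Proof. by move=> [????] [????] [????]; congr Quat => /=; ring. Qed.

Lemma mulqDr : right_distributive mulq addq.
Proof. by move=> [????] [????] [????]; congr Quat => /=; ring. Qed.

Lemma oneq_neq0 : realq 1 != 0.
Proof. by apply/eqP => -[] /eqP; rewrite oner_eq0. Qed.

HB.instance Definition _ := GRing.Zmodule_isNzRing.Build (quat R)
  mulqA mul1q mulq1 mulqDl mulqDr oneq_neq0.

End QuatRing.

Variant scalar_kind := RealK | ComplexK | QuaternionK.

Definition scalar_ring (R : realType) (K : scalar_kind) : nzRingType :=
  match K with
  | RealK => R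
  | ComplexK => R[i]
  | QuaternionK => quat R
  end.

Definition of_real (R : realType) (K : scalar_kind) : R -> scalar_ring R K :=
  match K return R -> scalar_ring R K with
  | RealK => fun a => a
  | ComplexK => fun a => Complex a 0
  | QuaternionK => fun a => realq a
  end.

Definition conj_scalar (R : realType) (K : scalar_kind) :
    scalar_ring R K -> scalar_ring R K :=
  match K return scalar_ring R K -> scalar_ring R K with
  | RealK => fun a => a
  | ComplexK => fun a => conjc a
  | QuaternionK => fun a => conjq a
  end.

Section HermitianMatrices.
Variables (R : realType) (K : scalar_kind).
Local Notation D := (scalar_ring R K).

Definition adjmx m n (A : 'M[D]_(m, n)) : 'M[D]_(n, m) :=
  (map_mx (@conj_scalar R K) A)^T.

(* A scalar is > 0 when it is (the image of) a positive real number; for a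
   Hermitian A all the values of x^* A x are real. *)
Definition pos_scalar (z : D) : Prop := exists2 a : R, 0 < a & z = of_real K a.

Definition posdef n (A : 'M[D]_n) : Prop :=
  A = adjmx A /\
  forall x : 'cV[D]_n, x != 0 -> pos_scalar ((adjmx x *m A *m x) 0 0).

(* Right eigenvalues: X x = x c. *)
Definition Spec n (X : 'M[D]_n) : set D :=
  [set c | exists2 x : 'cV[D]_n, x != 0 & X *m x = x *m c%:M].

(* The library's [invmx] requires commutative coefficients. If X has no
   two-sided inverse, this is 0. *)
Definition inv_mat n (X : 'M[D]_n) : 'M[D]_n :=
  xget 0 [set Y | X *m Y = 1%:M /\ Y *m X = 1%:M].

Definition real_diag n (l : 'rV[R]_n) : 'M[D]_n :=
  diag_mx (map_mx (@of_real R K) l).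

(* Y = U diag(f(l_1), ..., f(l_n)) U^* for some unitary diagonalization
   X = U diag(l_1, ..., l_n) U^*. *)
Definition is_matfun n (f : R -> R) (X Y : 'M[D]_n) : Prop :=
  exists (U : 'M[D]_n) (l : 'rV[R]_n),
    [/\ U *m adjmx U = 1%:M,
        X = U *m real_diag l *m adjmx U &
        Y = U *m real_diag (map_mx f l) *m adjmx U].

(* f(X). The Y satisfying [is_matfun f X] does not depend on the choice of the
   diagonalization, and it exists when X is Hermitian; otherwise this is 0. *)
Definition matfun n (f : R -> R) (X : 'M[D]_n) : 'M[D]_n :=
  xget 0 [set Y | is_matfun f X Y].

Definition matpow n (X : 'M[D]_n) (s : R) : 'M[D]_n :=
  matfun (fun t : R => t `^ s) X.

Definition geomean n (A B : 'M[D]_n) : 'M[D]_n :=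
  matpow A (1 / 2)
  *m matpow (matpow A (- (1 / 2)) *m B *m matpow A (- (1 / 2))) (1 / 2)
  *m matpow A (1 / 2).

Definition altmean n (f : R -> R) (A B : 'M[D]_n) : 'M[D]_n :=
  matfun f (geomean (inv_mat A) B) *m A *m matfun f (geomean (inv_mat A) B).

End HermitianMatrices.

(* The elementary symmetric polynomial of degree k in m variables, at v. *)
Definition elem_sym (R : comNzRingType) (m k : nat) (v : 'I_m -> R) : R :=
  mpoly.meval v (mpoly.mesym m R k).

(* The square roots of the lam j for j != i, in increasing order of j. *)
Definition hat_sqrt (R : rcfType) (r : nat) (lam : 'I_r -> R) (i : 'I_r) :
    'I_r.-1 -> R :=
  fun j => Num.sqrt (lam (lift i j)).

Definition dcoef (R : rcfType) (f : R -> R) (r : nat) (lam : 'I_r -> R)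
    (k : nat) : R :=
  (-1) ^+ (r - 1 - k)%N *
  \sum_(i < r)
    f (Num.sqrt (lam i)) *
    (elem_sym (r - 1 - k)%N (hat_sqrt lam i) /
     \prod_(j < r | j != i) (Num.sqrt (lam i) - Num.sqrt (lam j))).

(* Main.v *)
(* Commuting Hermitian matrices over R, C or H are simultaneously
   diagonalizable by a unitary U. For A = U diag(a) U^* and B = U diag(b) U^*
   every matrix of the theorem has the form U diag(l) U^*, so both identities
   reduce to scalar ones at the eigenvalues mu = b / a: the d_k are the
   coefficients of the Lagrange polynomial interpolating f at the points
   sqrt(lambda_i).

   The spectral theorem is proved uniformly in the three cases. Seen as real
   matrices, A and B commute, hence have a common complex eigenvector;
   hermitianity makes the eigenvalues real, which yields a common eigenvector
   with entries in the scalars. A Householder reflection moves it to the first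
   basis vector and reduces the dimension. *)
Require Import Defs.
From HB Require Import structures.
From mathcomp Require Import all_boot all_order all_algebra.
From mathcomp Require Import complex spectral ring.
From mathcomp Require Import all_classical all_reals all_analysis.
From mathcomp Require mpoly.

Set Implicit Arguments.
Unset Strict Implicit.
Unset Printing Implicit Defensive.

Import Order.TTheory GRing.Theory Num.Theory.
Import numFieldNormedType.Exports.

Local Open Scope classical_set_scope.
Local Open Scope ring_scope.

(** * The three scalar rings as real algebras with conjugation *)

Section Scalars.
Variables (R : realType) (K : scalar_kind).
Local Notation D := (scalar_ring R K).
Local Notation "a %:D" := (@of_real R K a) (at level 2, format "a %:D").
Local Notation conjD := (@conj_scalar R K).

Fact of_real_is_zmod_morphism : zmod_morphism (@of_real R K).
Proof.
move=> a b; case: K => //=; first by rewrite -[RHS](rmorphB (real_complex R)).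
by congr Quat => /=; rewrite subr0.
Qed.

Fact of_real_is_monoid_morphism : monoid_morphism (@of_real R K).
Proof.
split=> [|a b]; case: K => //=; first by rewrite -[RHS](rmorphM (real_complex R)).
by congr Quat => /=; ring.
Qed.

HB.instance Definition _ :=
  GRing.isZmodMorphism.Build R D (@of_real R K) of_real_is_zmod_morphism.
HB.instance Definition _ :=
  GRing.isMonoidMorphism.Build R D (@of_real R K) of_real_is_monoid_morphism.

Lemma of_real_inj : injective (@of_real R K).
Proof. by case: K => a b //= []. Qed.

Lemma of_real_comm a (z : D) : a%:D * z = z * a%:D.
Proof.
case: K z => /= z; [exact: mulrC | exact: mulrC |].
by case: z => *; congr Quat => /=; ring.
Qed.

Fact conj_scalar_is_zmod_morphism : zmod_morphism conjD.
Proof.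
case: K => //= x y; first exact: rmorphB.
by congr Quat => /=; rewrite opprD.
Qed.

HB.instance Definition _ :=
  GRing.isZmodMorphism.Build D D conjD conj_scalar_is_zmod_morphism.

Lemma conj_scalarM x y : conjD (x * y) = conjD y * conjD x.
Proof.
case: K x y => /= x y; first exact: mulrC.
- by rewrite rmorphM mulrC.
- by case: x y => [????] [????]; congr Quat => /=; ring.
Qed.

Lemma conj_scalarK : involutive conjD.
Proof.
case: K => //= x; first exact: conjcK.
by case: x => *; rewrite /conjq /= !opprK.
Qed.

Lemma conj_of_real a : conjD a%:D = a%:D.
Proof. by case: K => //=; rewrite /conjc /conjq /= ?oppr0. Qed.

Definition norm2 : D -> R :=
  match K return scalar_ring R K -> R with
  | RealK => fun z => z ^+ 2
  | ComplexK => fun z => complex.Re z ^+ 2 + complex.Im z ^+ 2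
  | QuaternionK => fun z => qre z ^+ 2 + qi z ^+ 2 + qj z ^+ 2 + qk z ^+ 2
  end.

Lemma mul_conj_scalar z : conjD z * z = (norm2 z)%:D.
Proof.
rewrite /norm2; case: K z => //= z.
  by case: z => a b /=; congr Complex => /=; ring.
by case: z => *; congr Quat => /=; ring.
Qed.

Lemma norm2_ge0 z : 0 <= norm2 z.
Proof.
by rewrite /norm2; case: K z => /= z; rewrite ?addr_ge0 ?sqr_ge0.
Qed.

Lemma norm2_eq0 z : (norm2 z == 0) = (z == 0).
Proof.
rewrite /norm2; case: K z => /= z; first exact: sqrf_eq0.
- rewrite paddr_eq0 ?sqr_ge0 // !sqrf_eq0.
  apply/idP/eqP => [|-> /=]; last by rewrite eqxx.
  by case: z => a b /= /andP[/eqP-> /eqP->].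
- rewrite !paddr_eq0 ?addr_ge0 ?sqr_ge0 // !sqrf_eq0.
  apply/idP/eqP => [|-> /=]; last by rewrite eqxx.
  by case: z => a b c d /= /andP[/andP[/andP[/eqP-> /eqP->] /eqP->] /eqP->].
Qed.

Definition dimD : nat :=
  match K with RealK => 1 | ComplexK => 2 | QuaternionK => 4 end.

(** The return type spells out [dimD] as a match so that it reduces to a concrete dimension in each
    branch. *)
Definition coords : D -> 'rV[R]_dimD :=
  match K return scalar_ring R K ->
    'rV[R]_(match K with RealK => 1 | ComplexK => 2 | QuaternionK => 4 end) with
  | RealK => fun z => \row_i z
  | ComplexK => fun z => \row_i [:: complex.Re z; complex.Im z]`_i
  | QuaternionK => fun z => \row_i [:: qre z; qi z; qj z; qk z]`_i
  end.

Definition of_coords : 'rV[R]_dimD -> D :=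
  match K return
    'rV[R]_(match K with RealK => 1 | ComplexK => 2 | QuaternionK => 4 end) ->
    scalar_ring R K with
  | RealK => fun v => v 0 0
  | ComplexK => fun v => Complex (v 0 0) (v 0 1)
  | QuaternionK => fun v =>
      Quat (v 0 0) (v 0 1) (v 0 (inord 2)) (v 0 (inord 3))
  end.

Lemma coordsK : cancel coords of_coords.
Proof.
rewrite /coords /of_coords /dimD; case: K => /= z; rewrite !mxE //=.
- by case: z.
- by rewrite !inordK //; case: z.
Qed.

Lemma of_coordsK : cancel of_coords coords.
Proof.
rewrite /coords /of_coords /dimD; case: K => /= v; apply/rowP => i; rewrite mxE.
- by rewrite ord1.
- by case: i => [[|[|]]] //= h; congr (v _ _); apply: val_inj.
- by case: i => [[|[|[|[|]]]]] //= h; congr (v _ _); apply: val_inj;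
    rewrite //= inordK.
Qed.

Lemma of_coordsP a v w : of_coords (a *: v + w) = a%:D * of_coords v + of_coords w.
Proof.
rewrite /of_coords /dimD; move: v w; rewrite /dimD; case: K => /= v w; rewrite !mxE //.
- by congr Complex => /=; ring.
- by congr Quat => /=; ring.
Qed.

Lemma coordsP a x y : coords (a%:D * x + y) = a *: coords x + coords y.
Proof. by apply: (can_inj of_coordsK); rewrite coordsK of_coordsP !coordsK. Qed.
End Scalars.

(** * Adjoints and squared norms over [D] *)

Section Matrices.
Variables (R : realType) (K : scalar_kind).
Local Notation D := (scalar_ring R K).
Local Notation "a %:D" := (@of_real R K a) (at level 2, format "a %:D").
Local Notation d := (dimD K).

Fact adjmx_is_zmod_morphism m n : zmod_morphism (@adjmx R K m n).
Proof. by move=> A B; rewrite /adjmx map_mxB linearB. Qed.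

HB.instance Definition _ m n :=
  GRing.isZmodMorphism.Build 'M[D]_(m, n) 'M[D]_(n, m) (@adjmx R K m n)
    (@adjmx_is_zmod_morphism m n).

Lemma adjmxM m n p (A : 'M[D]_(m, n)) (B : 'M[D]_(n, p)) :
  adjmx (A *m B) = adjmx B *m adjmx A.
Proof.
apply/matrixP => i j; rewrite !mxE raddf_sum; apply: eq_bigr => k _ /=.
by rewrite !mxE conj_scalarM.
Qed.

Lemma adjmxK m n (A : 'M[D]_(m, n)) : adjmx (adjmx A) = A.
Proof. by apply/matrixP => i j; rewrite !mxE conj_scalarK. Qed.

Lemma adjmx_scale_real m n a (A : 'M[D]_(m, n)) :
  adjmx (a%:D *: A) = a%:D *: adjmx A.
Proof.
by apply/matrixP => i j; rewrite !mxE conj_scalarM conj_of_real of_real_comm.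
Qed.

Lemma adjmx1 n : adjmx (1%:M : 'M[D]_n) = 1%:M.
Proof.
apply/matrixP => i j; rewrite !mxE eq_sym.
by case: eqP; rewrite ?mulr1n ?mulr0n ?raddf0 // -(rmorph1 (@of_real R K)) conj_of_real.
Qed.

(** Real scalars are central, so they pass through a left factor even over the quaternions. *)
Lemma scale_real_mulmxr m n p a (A : 'M[D]_(m, n)) (B : 'M[D]_(n, p)) :
  A *m (a%:D *: B) = a%:D *: (A *m B).
Proof.
apply/matrixP => i j; rewrite !mxE mulr_sumr; apply: eq_bigr => k _.
by rewrite !mxE !mulrA of_real_comm.
Qed.

Lemma mulmx_real_scalar m n a (A : 'M[D]_(m, n)) :
  A *m (a%:D)%:M = a%:D *: A.
Proof. by rewrite -scalemx1 scale_real_mulmxr mulmx1. Qed.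

Definition vnorm2 n (x : 'cV[D]_n) : R := \sum_i norm2 (x i 0).

Lemma mul_adjmx_vec n (x : 'cV[D]_n) : adjmx x *m x = ((vnorm2 x)%:D)%:M.
Proof.
apply/matrixP => i j; rewrite !ord1 !mxE mulr1n raddf_sum.
by apply: eq_bigr => k _; rewrite !mxE mul_conj_scalar.
Qed.

Lemma vnorm2_ge0 n (x : 'cV[D]_n) : 0 <= vnorm2 x.
Proof. by apply: sumr_ge0 => i _; exact: norm2_ge0. Qed.

Lemma vnorm2_eq0 n (x : 'cV[D]_n) : (vnorm2 x == 0) = (x == 0).
Proof.
apply/idP/eqP => [|->]; last first.
  by rewrite /vnorm2 big1 // => i _; rewrite mxE; apply/eqP; rewrite norm2_eq0.
rewrite /vnorm2 psumr_eq0 => [/allP x0|i _]; last exact: norm2_ge0.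
apply/colP => i; rewrite mxE; apply/eqP; rewrite -norm2_eq0.
by apply: x0; rewrite mem_index_enum.
Qed.

(** * Real representation of matrices over D *)

Definition vec_coords n (x : 'cV[D]_n) : 'M[R]_(n, d) :=
  \matrix_(i, j) coords (x i 0) 0 j.

Definition coords_vec n (v : 'M[R]_(n, d)) : 'cV[D]_n :=
  \col_i of_coords (row i v).

Lemma vec_coordsK n : cancel (@vec_coords n) (@coords_vec n).
Proof.
move=> x; apply/colP => i; rewrite mxE -[RHS]coordsK; congr of_coords.
by apply/rowP => j; rewrite !mxE.
Qed.

Lemma coords_vecK n : cancel (@coords_vec n) (@vec_coords n).
Proof. by move=> v; apply/matrixP => i j; rewrite !mxE of_coordsK mxE. Qed.

Lemma vec_coordsP n a (x y : 'cV[D]_n) :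
  vec_coords (a%:D *: x + y) = a *: vec_coords x + vec_coords y.
Proof. by apply/matrixP => i j; rewrite !mxE coordsP !mxE. Qed.

Lemma coords_vecP n a (v w : 'M[R]_(n, d)) :
  coords_vec (a *: v + w) = a%:D *: coords_vec v + coords_vec w.
Proof. by apply: (can_inj (@vec_coordsK n)); rewrite vec_coordsP !coords_vecK. Qed.

Fact coords_vec_is_zmod_morphism n : zmod_morphism (@coords_vec n).
Proof.
move=> v w; rewrite addrC -scaleN1r coords_vecP rmorphN1 scaleN1r.
exact: addrC.
Qed.

HB.instance Definition _ n :=
  GRing.isZmodMorphism.Build 'M[R]_(n, d) 'cV[D]_n (@coords_vec n)
    (@coords_vec_is_zmod_morphism n).

Lemma coords_vecZ n a (v : 'M[R]_(n, d)) :
  coords_vec (a *: v) = a%:D *: coords_vec v.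
Proof. by rewrite -[a *: v]addr0 coords_vecP raddf0 addr0. Qed.

Definition real_action n (A : 'M[D]_n) (v : 'M[R]_(n, d)) : 'M[R]_(n, d) :=
  vec_coords (A *m coords_vec v).

Fact real_action_is_linear n (A : 'M[D]_n) : linear (real_action A).
Proof.
move=> a v w; rewrite /real_action coords_vecP mulmxDr scale_real_mulmxr.
exact: vec_coordsP.
Qed.

HB.instance Definition _ n (A : 'M[D]_n) :=
  GRing.isLinear.Build R 'M[R]_(n, d) 'M[R]_(n, d) _ (real_action A)
    (real_action_is_linear A).

(** Transfers to [D] facts known for commutative coefficients. Since [lin_mx] acts on row vectors
    from the right, products are reversed. *)
Definition real_repr n (A : 'M[D]_n) : 'M[R]_(n * d) := lin_mx (real_action A).

Lemma real_reprM n (A B : 'M[D]_n) : real_repr (A *m B) = real_repr B *m real_repr A.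
Proof.
apply/row_matrixP => i; rewrite !rowE mulmxA -[delta_mx 0 i]vec_mxK.
by rewrite !mul_vec_lin /= /real_action vec_coordsK mulmxA.
Qed.

Lemma real_repr1 n : real_repr (1%:M : 'M[D]_n) = 1%:M.
Proof.
apply/row_matrixP => i; rewrite !rowE -[delta_mx 0 i]vec_mxK.
by rewrite !mul_vec_lin /= /real_action mul1mx coords_vecK mulmx1.
Qed.

Lemma real_repr_inj n : injective (@real_repr n).
Proof.
move=> A B AB; apply/matrixP => i j.
have E (x : 'cV[D]_n) : A *m x = B *m x.
  apply: (can_inj (@vec_coordsK n)); apply: (can_inj mxvecK).
  have := congr1 (mulmx (mxvec (vec_coords x))) AB.
  by rewrite !mul_vec_lin /= /real_action vec_coordsK.
have := E (delta_mx j 0); rewrite -!colE => /colP/(_ i).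
by rewrite !mxE.
Qed.

(** Right inverses of real square matrices are left inverses, and the real representation is
    faithful. *)
Lemma mulmx1_sym n (A B : 'M[D]_n) : A *m B = 1%:M -> B *m A = 1%:M.
Proof.
move=> AB; apply: real_repr_inj; rewrite real_reprM real_repr1.
by apply: mulmx1C; rewrite -real_reprM AB real_repr1.
Qed.

(* A common complex eigenvector [v + i w] of the real representations splits
   into [v, w] with [A v = a v - b w] and [A w = b v + a w]; evaluating
   [w^* A v] and [v^* A w] gives [b (|v|^2 + |w|^2) = 0]. *)
Lemma hermitian_complex_eigenvalue n (A : 'M[D]_n) (v w : 'cV[D]_n) (a b : R) :
  A = adjmx A -> A *m v = a%:D *: v - b%:D *: w ->
  A *m w = b%:D *: v + a%:D *: w -> (v != 0) || (w != 0) -> b = 0.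
Proof.
move=> hA Av Aw vw0.
have E1 := congr1 (mulmx (adjmx v)) Aw.
have E2 := congr1 (fun x => adjmx x *m w) Av.
move: E1; rewrite /= mulmxA {1}hA -adjmxM E2.
rewrite raddfB /= !adjmx_scale_real mulmxBl mulmxDr !scale_real_mulmxr -!scalemxAl.
rewrite !mul_adjmx_vec addrC => /addIr/matrixP/(_ 0 0)/eqP.
rewrite !mxE !mulr1n -!rmorphM eq_sym -addr_eq0 -rmorphD /=.
rewrite -(rmorph0 (@of_real R K)) => /eqP/of_real_inj.
rewrite -mulrDr => /eqP; rewrite mulf_eq0 => /orP[/eqP //|].
rewrite paddr_eq0 ?vnorm2_ge0 // !vnorm2_eq0 => /andP[w0 v0].
by move: vw0; rewrite w0 v0.
Qed.
End Matrices.

(** * Simultaneous diagonalization of commuting Hermitian matrices *)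

Section Diagonalization.
Variables (R : realType) (K : scalar_kind).
Local Notation D := (scalar_ring R K).
Local Notation "a %:D" := (@of_real R K a) (at level 2, format "a %:D").

Lemma complex_eigenvector_split N (M : 'M[R]_N) (u : 'rV[R[i]]_N) (z : R[i]) :
  u *m map_mx (real_complex R) M = z *: u ->
  let v := map_mx (@complex.Re R) u in let w := map_mx (@complex.Im R) u in
  v *m M = complex.Re z *: v - complex.Im z *: w /\
  w *m M = complex.Im z *: v + complex.Re z *: w.
Proof.
move=> uM v w.
(* Taking real or imaginary parts is additive and R-linear, so it commutes with the real matrix [M];
   [g] stands for either map. *)
have coef (g : R[i] -> R) (g0 : g 0 = 0) (gD : {morph g : x y / x + y})
    (gM : forall x a, g (x * (real_complex R a)) = g x * a) :
    map_mx g u *m M = map_mx g (z *: u).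
  rewrite -uM; apply/rowP => j; rewrite !mxE (big_morph g gD g0).
  by apply: eq_bigr => k _; rewrite !mxE gM.
have ReM (x y : R[i]) : complex.Re (x * y) =
    complex.Re x * complex.Re y - complex.Im x * complex.Im y.
  by case: x; case: y.
have ImM (x y : R[i]) : complex.Im (x * y) =
    complex.Im x * complex.Re y + complex.Re x * complex.Im y.
  by case: x => a b; case: y => c e /=; rewrite addrC.
split; rewrite coef //.
- by apply/rowP => j; rewrite !mxE ReM.
- by move=> [??] [].
- by move=> x a; rewrite ReM /= mulr0 subr0.
- by apply/rowP => j; rewrite !mxE ImM.
- by move=> [??] [].
- by move=> x a; rewrite ImM /= mulr0 addr0.
Qed.

Lemma real_repr_eigenvector n (A : 'M[D]_n) (v w : 'rV[R]_(n * dimD K)) (a b : R) :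
  v *m real_repr A = a *: v + b *: w ->
  A *m coords_vec (vec_mx v) =
    a%:D *: coords_vec (vec_mx v) + b%:D *: coords_vec (vec_mx w).
Proof.
rewrite -{1}[v]vec_mxK mul_vec_lin /= /real_action => /(congr1 vec_mx).
rewrite mxvecK => /(congr1 (@coords_vec R K n)); rewrite vec_coordsK => ->.
by rewrite linearD /= [in LHS]linearZ coords_vecP [in LHS]linearZ coords_vecZ.
Qed.

Lemma hermitian_common_eigenvector n (A B : 'M[D]_n) :
  (0 < n)%N -> A = adjmx A -> B = adjmx B -> A *m B = B *m A ->
  exists (v : 'cV[D]_n) (a b : R),
    [/\ v != 0, A *m v = a%:D *: v & B *m v = b%:D *: v].
Proof.
move=> n0 hA hB AB.
pose C := map_mx (real_complex R).
have [||u u0 /andP[/sub_rVP[x ux] /sub_rVP[y uy]]] :=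
    @common_eigenvector2 R[i] _ (C _ _ (real_repr A)) (C _ _ (real_repr B)).
- by rewrite muln_gt0 n0 /dimD; case: (K).
- by rewrite -!map_mxM -!real_reprM AB.
have [vx wx] := complex_eigenvector_split ux.
have [vy wy] := complex_eigenvector_split uy.
set v := map_mx _ u in vx wx vy wy; set w := map_mx _ u in vx wx vy wy.
(* The relations are put in the form [a *: v + b *: w] of [real_repr_eigenvector], with [v] and [w]
   exchanged in those for [w]. *)
rewrite -scaleNr in vx; rewrite -scaleNr in vy.
rewrite addrC in wx; rewrite addrC in wy.
move/real_repr_eigenvector: vx; move/real_repr_eigenvector: wx.
move/real_repr_eigenvector: vy; move/real_repr_eigenvector: wy.
set v' := coords_vec (vec_mx v); set w' := coords_vec (vec_mx w).
rewrite !rmorphN !scaleNr => Bw Bv Aw Av; rewrite addrC in Aw; rewrite addrC in Bw.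
have vw0 : (v' != 0) || (w' != 0).
  rewrite -negb_and; apply: contra u0 => /andP[/eqP v0 /eqP w0].
  have z0 (t : 'rV[R]_(n * dimD K)) : coords_vec (vec_mx t) = 0 :> 'cV[D]_n -> t = 0.
    rewrite -(raddf0 (@coords_vec R K n)) => /(can_inj (@coords_vecK R K n)) t0.
    by rewrite -[t]vec_mxK t0 linear0.
  apply/eqP/rowP => j; rewrite mxE.
  have /rowP/(_ j) := z0 _ v0; have /rowP/(_ j) := z0 _ w0.
  by rewrite !mxE; case: (u 0 j) => ? ? /= -> ->.
(* Both eigenvalues are real, so [v'] and [w'] each satisfy the eigenvector equations and a nonzero
   one serves. *)
have x0 := hermitian_complex_eigenvalue hA Av Aw vw0.
have y0 := hermitian_complex_eigenvalue hB Bv Bw vw0.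
move: Av Aw Bv Bw; rewrite x0 y0 !(rmorph0 (@of_real R K)) !scale0r !subr0 !add0r => Av Aw Bv Bw.
by case/orP: vw0 => nz; [exists v' | exists w']; exists (complex.Re x), (complex.Re y).
Qed.

(** The squared norm of [v p] is [p^* v^* v p], where [v^* v] is real, hence central. *)
Lemma vnorm2_mul_scalar n (v : 'cV[D]_n) p :
  vnorm2 (v *m p%:M) = vnorm2 v * norm2 p.
Proof.
apply: (@of_real_inj R K); have := mul_adjmx_vec (v *m p%:M).
rewrite adjmxM mulmxA -(mulmxA _ _ v) mul_adjmx_vec mulmx_real_scalar.
rewrite -scalemxAl => /matrixP/(_ 0 0); rewrite !mxE big_ord1 !mxE !mulr1n => <-.
by rewrite mul_conj_scalar -rmorphM.
Qed.

(* The reflection in the hyperplane orthogonal to [u = w + e]. Since [e^* w] is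
   a real [c >= 0], one has [u^* u = 2 (1 + c)] and [u^* e = 1 + c]. *)
Lemma householder n (e w : 'cV[D]_n) c :
  vnorm2 e = 1 -> vnorm2 w = 1 -> 0 <= c -> adjmx e *m w = (c%:D)%:M ->
  exists H : 'M[D]_n, [/\ adjmx H = H, H *m H = 1%:M & H *m e = - w].
Proof.
move=> e1 w1 c0 ew; pose u := w + e.
have we : adjmx w *m e = (c%:D)%:M.
  have := congr1 (@adjmx R K _ _) ew; rewrite adjmxM adjmxK => ->.
  by rewrite -scalemx1 adjmx_scale_real adjmx1.
have ue : adjmx u *m e = ((1 + c)%:D)%:M.
  rewrite raddfD mulmxDl /= we mul_adjmx_vec e1 -raddfD -rmorphD /=.
  by rewrite addrC.
have uw : adjmx u *m w = ((1 + c)%:D)%:M.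
  by rewrite raddfD mulmxDl /= ew mul_adjmx_vec w1 -raddfD -rmorphD.
have uu : adjmx u *m u = ((2 * (1 + c))%:D)%:M.
  by rewrite {2}/u mulmxDr uw ue -raddfD -rmorphD /= mulr_natl mulr2n.
have c1 : 1 + c != 0 by rewrite gt_eqF // ltr_pwDl.
(* This is the identity minus [2 u u^*] divided by [u^* u]. As [c >= 0], the denominator is nonzero;
   [w - e] in place of [w + e] would fail for [w = e]. *)
exists (1%:M - (1 + c)^-1%:D *: (u *m adjmx u)); split.
- by rewrite raddfB /= adjmx1 adjmx_scale_real adjmxM adjmxK.
- rewrite mulmxBl mul1mx mulmxBr mulmx1 scale_real_mulmxr -scalemxAl.
  rewrite mulmxA -(mulmxA u) uu mulmx_real_scalar -scalemxAl !scalerA -!rmorphM.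
  rewrite (_ : _ * _ = (1 + c)^-1 *+ 2); last by field.
  by rewrite raddfMn -scalerMnl mulr2n opprB addrK subrK.
- rewrite mulmxBl mul1mx -scalemxAl -mulmxA ue mulmx_real_scalar scalerA.
  by rewrite -rmorphM mulVf // rmorph1 scale1r opprD addrCA subrr addr0.
Qed.

(* Up to a positive real factor, [p] is the conjugate of [e^* v] (or 1). *)
Lemma align_unit_vector n (e v : 'cV[D]_n) : v != 0 ->
  exists (p : D) (c : R), [/\ vnorm2 (v *m p%:M) = 1, 0 <= c &
    adjmx e *m (v *m p%:M) = (c%:D)%:M].
Proof.
move=> v0; pose z := (adjmx e *m v) 0 0.
have ev : adjmx e *m v = z%:M by apply/matrixP => i j; rewrite !ord1 [RHS]mxE.
have [p [c [p0 c0 zp]]] : exists p c, [/\ p != 0, 0 <= c & z * p = c%:D].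
  have [->|z0] := eqVneq z 0; first by exists 1, 0; rewrite oner_eq0 mul0r rmorph0.
  exists (conj_scalar z), (norm2 (conj_scalar z)); split; last first.
  - by rewrite -mul_conj_scalar conj_scalarK.
  - exact: norm2_ge0.
  - by apply: contra z0 => /eqP z0; rewrite -[z]conj_scalarK z0 raddf0.
have N0 : 0 < vnorm2 v * norm2 p.
  by rewrite mulr_gt0 // lt_neqAle ?vnorm2_ge0 ?norm2_ge0 eq_sym ?vnorm2_eq0
    ?norm2_eq0 ?v0 ?p0.
(* [N] is the squared norm of [v p], so scaling by the positive real [s] yields a unit vector. *)
set N := _ * _ in N0; pose s := (Num.sqrt N)^-1.
have s0 : 0 <= s by rewrite invr_ge0 sqrtr_ge0.
have ps : v *m (p * s%:D)%:M = s%:D *: (v *m p%:M).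
  by rewrite scalar_mxM mulmxA mulmx_real_scalar.
exists (p * s%:D), (s * c); split; last 2 first.
- by rewrite mulr_ge0.
- by rewrite ps scale_real_mulmxr mulmxA ev -scalar_mxM zp scale_scalar_mx -rmorphM.
rewrite ps -mulmx_real_scalar !vnorm2_mul_scalar -/N.
have -> : norm2 s%:D = s ^+ 2.
  by apply: (@of_real_inj R K); rewrite -mul_conj_scalar conj_of_real -rmorphM expr2.
by rewrite /s exprVn sqr_sqrtr ?ltW // divff ?gt_eqF.
Qed.

Lemma real_diag_row_mx m n (l1 : 'rV[R]_m) (l2 : 'rV[R]_n) :
  real_diag K (row_mx l1 l2) = block_mx (real_diag K l1) 0 0 (real_diag K l2).
Proof. by rewrite /real_diag map_row_mx diag_mx_row. Qed.

Lemma adjmx_block m1 m2 n1 n2 (A : 'M[D]_(m1, n1)) (B : 'M[D]_(m1, n2))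
    (C : 'M[D]_(m2, n1)) (E : 'M[D]_(m2, n2)) :
  adjmx (block_mx A B C E) =
  block_mx (adjmx A) (adjmx C) (adjmx B) (adjmx E).
Proof. by rewrite /adjmx map_block_mx tr_block_mx. Qed.

(** The eigenvector equation determines the first column, and hermitianity then clears the rest of
    the first row. *)
Lemma hermitian_eigenvector_block n (A : 'M[D]_(1 + n)) a :
  A = adjmx A -> A *m col_mx 1%:M 0 = a%:D *: col_mx 1%:M 0 ->
  A = block_mx (real_diag K (const_mx a)) 0 0 (drsubmx A).
Proof.
move=> hA; rewrite -{1}[A]submxK mul_block_col !mulmx1 !mulmx0 !addr0.
rewrite scale_col_mx scaler0 scalemx1 => /eq_col_mx[ul dl].
have ur : ursubmx A = 0.
  move: hA; rewrite -{1 2}[A]submxK adjmx_block => /eq_block_mx[_ -> _ _].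
  by rewrite dl raddf0.
rewrite -{1}[A]submxK ul ur dl; congr block_mx.
by apply/matrixP => i j; rewrite !ord1 !mxE.
Qed.

(** Induction on [n]. The reflection [H] is its own adjoint and inverse; conjugation by it splits
    off a real 1 x 1 block from [A] and [B] at once and leaves smaller commuting Hermitian
    blocks. *)
Theorem hermitian_simultaneous_diag n (A B : 'M[D]_n) :
  A = adjmx A -> B = adjmx B -> A *m B = B *m A ->
  exists (U : 'M[D]_n) (a b : 'rV[R]_n),
    [/\ U *m adjmx U = 1%:M, A = U *m real_diag K a *m adjmx U &
        B = U *m real_diag K b *m adjmx U].
Proof.
elim: n A B => [|n IHn] A B hA hB AB.
  by exists 1%:M, 0, 0; split; apply/matrixP => -[].
have [v [a [b [v0 Av Bv]]]] := hermitian_common_eigenvector (ltn0Sn n) hA hB AB.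
pose e : 'cV[D]_(1 + n) := col_mx 1%:M 0.
have e1 : vnorm2 e = 1.
  apply: (@of_real_inj R K); have := mul_adjmx_vec e.
  rewrite /adjmx map_col_mx tr_col_mx mul_row_col mulmx0 addr0 mulmx1.
  by rewrite -/(adjmx _) adjmx1 => /matrixP/(_ 0 0); rewrite !mxE !mulr1n rmorph1.
have [p [c [w1 c0 ew]]] := align_unit_vector e v0.
have [H [hH HH He]] := householder e1 w1 c0 ew.
set w := v *m p%:M in w1 ew He.
have Hw : H *m w = - e by rewrite -[w]opprK -He mulmxN mulmxA HH mul1mx.
have conj_block (C : 'M[D]_(1 + n)) x : C = adjmx C -> C *m v = x%:D *: v ->
    exists2 C1 : 'M[D]_n, C1 = adjmx C1 &
      H *m C *m H = block_mx (real_diag K (const_mx x)) 0 0 C1.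
  move=> hC Cv; pose C' := H *m C *m H.
  have hC' : C' = adjmx C' by rewrite !adjmxM hH -hC mulmxA.
  (* Scaling by [p] on the right preserves the eigenvector equation, and the signs in [H e = - w]
     and [H w = - e] cancel. *)
  have C'e : C' *m e = x%:D *: e.
    rewrite -mulmxA He mulmxN -mulmxA /w [C *m _]mulmxA Cv -scalemxAl.
    by rewrite scale_real_mulmxr Hw scalerN opprK.
  exists (drsubmx C'); last exact: hermitian_eigenvector_block.
  by move: hC'; rewrite -{1 2}[C']submxK adjmx_block => /eq_block_mx[].
have [A1 hA1 HAH] := conj_block _ _ hA Av.
have [B1 hB1 HBH] := conj_block _ _ hB Bv.
have A1B1 : A1 *m B1 = B1 *m A1.
  have : (H *m A *m H) *m (H *m B *m H) = (H *m B *m H) *m (H *m A *m H).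
    by rewrite !mulmxA -!(mulmxA _ H H) HH !mulmx1 -!(mulmxA H) AB.
  rewrite HAH HBH !mulmx_block !mulmx0 !mul0mx !add0r => /eq_block_mx[_ _ _].
  by [].
have [U1 [a1 [b1 [U1U1 dA1 dB1]]]] := IHn _ _ hA1 hB1 A1B1.
pose U := H *m block_mx 1%:M 0 0 U1.
have dC (C : 'M[D]_(1 + n)) x C1 l :
    H *m C *m H = block_mx (real_diag K (const_mx x)) 0 0 C1 ->
    C1 = U1 *m real_diag K l *m adjmx U1 ->
    C = U *m real_diag K (row_mx (const_mx x) l) *m adjmx U.
  move=> HCH dC1; have -> : C = H *m (H *m C *m H) *m H.
    by rewrite !mulmxA HH mul1mx -mulmxA HH mulmx1.
  have -> : H *m C *m H = block_mx 1%:M 0 0 U1 *m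
      real_diag K (row_mx (const_mx x) l) *m block_mx 1%:M 0 0 (adjmx U1).
    rewrite HCH dC1 real_diag_row_mx !mulmx_block.
    by rewrite !(mulmx0, mul0mx, addr0, add0r, mul1mx, mulmx1).
  by rewrite adjmxM hH adjmx_block !raddf0 adjmx1 !mulmxA.
exists U, (row_mx (const_mx a) a1 : 'rV_(1 + n)),
  (row_mx (const_mx b) b1 : 'rV_(1 + n)); split.
- change (U *m adjmx U = 1%:M).
  rewrite adjmxM hH adjmx_block !raddf0 adjmx1 mulmxA -(mulmxA H) mulmx_block.
  rewrite !(mulmx0, mul0mx, addr0, add0r, mulmx1) U1U1 -scalar_mx_block.
  by rewrite mulmx1.
- exact: dC HAH dA1.
- exact: dC HBH dB1.
Qed.
End Diagonalization.

(** * Lagrange interpolation *)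

Section Interpolation.

(** Vieta's formulas, evaluated at [x]. *)
Lemma prod_sub_elem_sym (F : idomainType) n (s : 'I_n -> F) x :
  \prod_(j < n) (x - s j) =
  \sum_(k < n.+1) (-1) ^+ (n - k) * elem_sym (n - k) s * x ^+ k.
Proof.
pose P := \prod_(c <- [tuple s j | j < n]) ('X - c%:P).
have -> : \prod_(j < n) (x - s j) = P.[x].
  rewrite /P big_tuple horner_prod; apply: eq_bigr => j _.
  by rewrite tnth_mktuple hornerXsubC.
rewrite horner_coef size_prod_XsubC size_tuple; apply: eq_bigr => k _.
have kn : (k <= n)%N by rewrite -ltnS.
have nk : (n - k < n.+1)%N by rewrite ltnS leq_subr.
(* [mroots_coeff] counts coefficients from the top degree, hence the index [n - k]. *)
have := mpoly.mroots_coeff [tuple s j | j < n] (Ordinal nk).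
rewrite /= subKn // => ->; congr (_ * _ * _); apply: mpoly.meval_eq => j.
by rewrite tnth_mktuple.
Qed.

(** After exchanging the sums, Vieta's formulas turn the left-hand side into the Lagrange form of
    the interpolation polynomial. *)
Lemma dcoef_interpolation (R : rcfType) (f : R -> R) r (lam : 'I_r -> R) m :
  injective (fun i => Num.sqrt (lam i)) ->
  \sum_(k < r) dcoef f lam k * Num.sqrt (lam m) ^+ k = f (Num.sqrt (lam m)).
Proof.
case: r lam m => [lam []//|n lam m] s_inj; pose s i : R := Num.sqrt (lam i).
(* The value at [s m] of the [i]-th Lagrange basis polynomial: 1 for [i = m] and 0 otherwise. *)
pose L (i : 'I_n.+1) : R := \prod_(j < n) (s m - s (lift i j)) /
            \prod_(j < n.+1 | j != i) (s i - s j).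
transitivity (\sum_(i < n.+1) f (s i) * L i).
  under eq_bigr do rewrite /dcoef -mulrA mulr_suml mulr_sumr.
  rewrite exchange_big /=; apply: eq_bigr => i _.
  rewrite /L prod_sub_elem_sym mulr_suml mulr_sumr; apply: eq_bigr => k _.
  by rewrite subn1 /= /hat_sqrt /s; ring.
have prod_lift (i : 'I_n.+1) : \prod_(j < n.+1 | j != i) (s i - s j) =
    \prod_(j < n) (s i - s (lift i j)).
  rewrite big_mkcond /= (bigD1_ord i) //= eqxx mul1r.
  by apply: eq_bigr => j _; rewrite eq_sym neq_lift.
rewrite (bigD1 m) //= big1 ?addr0.
  rewrite /L prod_lift divff ?mulr1 //; apply/prodf_neq0 => j _.
  by rewrite subr_eq0; apply/eqP => /s_inj/eqP; rewrite (negbTE (neq_lift _ _)).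
(* For [i != m] the node [s m] is among the [s (lift i j)], so one factor vanishes. *)
move=> i im; rewrite /L.
have [j -> _] := unlift_some im.
by rewrite (bigD1 j) //= subrr mul0r mul0r mulr0.
Qed.

End Interpolation.

(** * Functional calculus in a fixed unitary basis *)

Section FunctionalCalculus.
Variables (R : realType) (K : scalar_kind).
Local Notation D := (scalar_ring R K).
Local Notation "a %:D" := (@of_real R K a) (at level 2, format "a %:D").

(** Right multiplication by the conjugate of [z] gives the real equation [a |z|^2 = 0]. *)
Lemma of_real_mul_eq0 a (z : D) : a%:D * z = 0 -> z != 0 -> a = 0.
Proof.
move=> az z0; have : (a * norm2 (conj_scalar z))%:D = 0 :> D.
  by rewrite rmorphM /= -mul_conj_scalar conj_scalarK mulrA az mul0r.
rewrite -(rmorph0 (@of_real R K)) => /of_real_inj/eqP; rewrite mulf_eq0 norm2_eq0.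
case/orP => [/eqP //|/eqP cz0].
by rewrite -[z]conj_scalarK cz0 raddf0 eqxx in z0.
Qed.

Lemma real_diag_mulE m n (l : 'rV[R]_m) (W : 'M[D]_(m, n)) i j :
  (real_diag K l *m W) i j = (l 0 i)%:D * W i j.
Proof. by rewrite mul_diag_mx !mxE. Qed.

Lemma mul_real_diagE m n (l : 'rV[R]_n) (W : 'M[D]_(m, n)) i j :
  (W *m real_diag K l) i j = (l 0 j)%:D * W i j.
Proof. by rewrite mul_mx_diag !mxE of_real_comm. Qed.

(** Entrywise, [l_i W_ij = W_ij l'_j] says that [W_ij = 0] or [l_i = l'_j]; either alternative gives
    the same relation after applying [f]. *)
Lemma real_diag_intertwine m n f (l : 'rV[R]_m) (l' : 'rV[R]_n) (W : 'M[D]_(m, n)) :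
  real_diag K l *m W = W *m real_diag K l' ->
  real_diag K (map_mx f l) *m W = W *m real_diag K (map_mx f l').
Proof.
move=> lW; apply/matrixP => i j; rewrite real_diag_mulE mul_real_diagE !mxE.
have /eqP := congr1 (fun M : 'M[D]_(m, n) => M i j) lW.
rewrite real_diag_mulE mul_real_diagE -subr_eq0 -mulrBl -rmorphB => /eqP/of_real_mul_eq0.
have [-> _|W0 /(_ isT)/eqP] := eqVneq (W i j) 0; first by rewrite !mulr0.
by rewrite subr_eq0 => /eqP ->.
Qed.

(** Common form of the matrices in the theorem: for a fixed unitary [U], all operations act
    entrywise on [l]. *)
Definition diag_conj n (U : 'M[D]_n) (l : 'rV[R]_n) : 'M[D]_n :=
  U *m real_diag K l *m adjmx U.

Section FixedBasis.
Variables (n : nat) (U : 'M[D]_n).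
Hypothesis UU : U *m adjmx U = 1%:M.
Implicit Types l m : 'rV[R]_n.

Let adjUU : adjmx U *m U = 1%:M. Proof. exact: mulmx1_sym. Qed.

Lemma diag_conjM l l' :
  diag_conj U l *m diag_conj U l' = diag_conj U (\row_i (l 0 i * l' 0 i)).
Proof.
rewrite /diag_conj !mulmxA -(mulmxA _ (adjmx U) U) adjUU mulmx1.
rewrite -(mulmxA U); congr (_ *m _ *m _); apply/matrixP => i j.
by rewrite real_diag_mulE !mxE mulrnAr rmorphM.
Qed.

Lemma diag_conj1 : diag_conj U (const_mx 1) = 1%:M.
Proof.
rewrite /diag_conj (_ : real_diag K _ = 1%:M) ?mulmx1 //.
by apply/matrixP => i j; rewrite !mxE rmorph1.
Qed.

Lemma scale_diag_conj c l : c%:D *: diag_conj U l = diag_conj U (c *: l).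
Proof.
rewrite /diag_conj scalemxAl -scale_real_mulmxr; congr (_ *m _ *m _).
by apply/matrixP => i j; rewrite !mxE mulrnAr rmorphM.
Qed.

Lemma diag_conj_sum (I : Type) (r : seq I) (F : I -> 'rV[R]_n) :
  \sum_(i <- r) diag_conj U (F i) = diag_conj U (\sum_(i <- r) F i).
Proof.
apply/esym/big_morph => [l l'|].
- rewrite /diag_conj -mulmxDl -mulmxDr; congr (_ *m _ *m _).
  by apply/matrixP => i j; rewrite !mxE rmorphD mulrnDl.
- rewrite /diag_conj (_ : real_diag K 0 = 0) ?mulmx0 ?mul0mx //.
  by apply/matrixP => i j; rewrite !mxE rmorph0 mul0rn.
Qed.

(** Independence of the diagonalization: if also [X = V diag(m) V^*], then [V^* U] intertwines [m]
    and [l], hence their images under [f]. *)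
Lemma matfun_diag_conj f l : matfun f (diag_conj U l) = diag_conj U (map_mx f l).
Proof.
apply: xget_unique; first by exists U, l.
move=> _ [V [m [VV XV ->]]]; have adjVV := mulmx1_sym VV.
have : real_diag K m *m (adjmx V *m U) = adjmx V *m U *m real_diag K l.
  have := congr1 (fun X => adjmx V *m X *m U) XV.
  rewrite /diag_conj !mulmxA -(mulmxA _ (adjmx U) U) adjUU mulmx1.
  by rewrite adjVV mul1mx -mulmxA => ->.
move/(real_diag_intertwine f)/(congr1 (fun X => V *m X *m adjmx U)).
rewrite /diag_conj !mulmxA VV mul1mx => <-.
by rewrite -(mulmxA _ U) UU mulmx1.
Qed.

Lemma matpow_diag_conj s l :
  matpow (diag_conj U l) s = diag_conj U (map_mx (fun t => t `^ s) l).
Proof. exact: matfun_diag_conj. Qed.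

Lemma inv_mat_diag_conj l : (forall i, l 0 i != 0) ->
  inv_mat (diag_conj U l) = diag_conj U (map_mx GRing.inv l).
Proof.
move=> l0; have lV : diag_conj U l *m diag_conj U (map_mx GRing.inv l) = 1%:M.
  rewrite diag_conjM -diag_conj1; congr diag_conj.
  by apply/rowP => i; rewrite !mxE divff.
apply: xget_unique; first by split=> //; exact: mulmx1_sym.
by move=> Y [_ YX]; rewrite -[Y]mulmx1 -lV mulmxA YX mul1mx.
Qed.

(** The quadratic form takes the value [l_i] at the column [U e_i]. *)
Lemma posdef_diag_conj_gt0 l i : posdef (diag_conj U l) -> 0 < l 0 i.
Proof.
case=> _ /(_ (U *m delta_mx i 0)) [|a a0].
  apply/eqP => /(congr1 (mulmx (adjmx U))); rewrite mulmxA adjUU mul1mx mulmx0.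
  by move/matrixP/(_ i 0)/eqP; rewrite !mxE !eqxx oner_eq0.
rewrite adjmxM /diag_conj !mulmxA -(mulmxA _ (adjmx U) U) adjUU mulmx1.
rewrite -(mulmxA _ (adjmx U) U) adjUU mulmx1 -mulmxA -colE mxE (bigD1 i) //= big1.
  rewrite addr0 !mxE !eqxx mulr1n -(rmorph1 (@of_real R K)) conj_of_real rmorph1.
  by rewrite mul1r => /of_real_inj ->.
by move=> j ji; rewrite !mxE (negbTE ji) mulr0n mulr0.
Qed.

(** In the coordinates [y = U^* x] the equation reads [l_i y_i = c y_i], so a nonzero [y_i] forces
    [l_i = c]; conversely [U e_i] is an eigenvector. *)
Lemma Spec_diag_conj l c :
  Spec (diag_conj U l) c%:D <-> exists i, l 0 i = c.
Proof.
split=> [[x x0 Xx]|[i <-]].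
  pose y := adjmx U *m x.
  have [i yi0] : exists i, y i 0 != 0.
    apply/existsP; apply: contraNT x0; rewrite negb_exists => /forallP y0.
    rewrite -[x]mul1mx -UU -mulmxA -/y (_ : y = 0) ?mulmx0 //.
    by apply/colP => i; rewrite [RHS]mxE; apply/eqP; rewrite -[_ == _]negbK y0.
  exists i; apply/eqP; rewrite -subr_eq0; apply/eqP; apply: of_real_mul_eq0 yi0.
  have : real_diag K l *m y = c%:D *: y.
    rewrite /y -scale_real_mulmxr -mulmx_real_scalar -Xx /diag_conj !mulmxA.
    by rewrite adjUU mul1mx.
  move/colP/(_ i); rewrite real_diag_mulE [RHS]mxE rmorphB mulrBl => ->.
  exact: subrr.
exists (U *m delta_mx i 0).
  apply/eqP => /(congr1 (mulmx (adjmx U))); rewrite mulmxA adjUU mul1mx mulmx0.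
  by move/matrixP/(_ i 0)/eqP; rewrite !mxE !eqxx oner_eq0.
rewrite mulmx_real_scalar /diag_conj !mulmxA -(mulmxA _ (adjmx U) U) adjUU mulmx1.
rewrite -mulmxA -scale_real_mulmxr; congr (_ *m _).
apply/matrixP => j k; rewrite real_diag_mulE !mxE.
by case: eqVneq => [->|] //=; rewrite !mulr0.
Qed.

(** With [s] the square root of [l_i], the definition gives [s (s^-1 m_i s^-1)^(1/2) s], which is
    [s] times the square root of [m_i]. *)
Lemma geomean_diag_conj l m : (forall i, 0 < l 0 i) -> (forall i, 0 < m 0 i) ->
  geomean (diag_conj U l) (diag_conj U m) =
  diag_conj U (\row_i Num.sqrt (l 0 i * m 0 i)).
Proof.
move=> l0 m0; rewrite /geomean !matpow_diag_conj !diag_conjM matpow_diag_conj.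
rewrite !diag_conjM; congr diag_conj; apply/rowP => i; rewrite !mxE.
rewrite !div1r powRN !powR12_sqrt ?ltW //; last first.
  by rewrite !mulr_gt0 ?invr_gt0 ?sqrtr_gt0.
have li := l0 i; have s0 : 0 < Num.sqrt (l 0 i) by rewrite sqrtr_gt0.
rewrite (sqrtrM _ (ltW li)); set s := Num.sqrt (l 0 i) in s0 *.
have -> : s^-1 * m 0 i / s = s^-1 ^+ 2 * m 0 i by rewrite mulrAC expr2.
rewrite sqrtrM ?sqr_ge0 // sqrtr_sqr gtr0_norm ?invr_gt0 //.
by rewrite mulrA divff ?mul1r 1?mulrC // gt_eqF.
Qed.
End FixedBasis.
End FunctionalCalculus.

(** * Reduction of the theorem to scalar identities *)

Lemma powR_half_nat (R : realType) (t : R) (k : nat) :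
  0 <= t -> t `^ (k%:R / 2) = Num.sqrt t ^+ k.
Proof.
by move=> t0; rewrite mulrC powRrM powR12_sqrt // powR_mulrn ?sqrtr_ge0.
Qed.

Theorem theorem7p4 (R : realType) (K : scalar_kind) (n : nat) (f : R -> R)
  (f_cont : {within [set t : R | 0 < t], continuous f})
  (f_pos : forall t : R, 0 < t -> 0 < f t)
  (f1 : f 1 = 1)
  (A B : 'M[scalar_ring R K]_n)
  (hA : posdef A) (hB : posdef B) (hAB : A *m B = B *m A)
  (r : nat) (lam : 'I_r -> R)
  (lam_inj : injective lam)
  (lam_spec : Spec (inv_mat A *m B) =
              [set of_real K (lam i) | i in [set: 'I_r]]) :
  matfun f (matpow (inv_mat A *m B) (1 / 2)) =
    \sum_(i < r) of_real K (dcoef f lam i) *: matpow (inv_mat A *m B) (i%:R / 2)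
  /\
  altmean f A B =
    \sum_(i < r) \sum_(j < r)
      of_real K (dcoef f lam i * dcoef f lam j) *:
        (A *m matpow (inv_mat A *m B) ((i + j)%:R / 2)).
Proof.
have [U [a [b [UU dA dB]]]] :=
  hermitian_simultaneous_diag (proj1 hA) (proj1 hB) hAB.
rewrite -/(diag_conj U _) in dA; rewrite -/(diag_conj U _) in dB; subst A B.
have a0 i : 0 < a 0 i := posdef_diag_conj_gt0 UU i hA.
have b0 i : 0 < b 0 i := posdef_diag_conj_gt0 UU i hB.
have an0 i : a 0 i != 0 by rewrite gt_eqF.
(* The eigenvalues of [A^-1 B] in the common basis, listed with multiplicity. *)
pose mu : 'rV[R]_n := \row_i ((a 0 i)^-1 * b 0 i).
have XE : inv_mat (diag_conj U a) *m diag_conj U b = diag_conj U mu.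
  rewrite inv_mat_diag_conj // diag_conjM //; congr diag_conj.
  by apply/rowP => i; rewrite !mxE.
rewrite XE in lam_spec *.
have mu0 i : 0 < mu 0 i by rewrite mxE mulr_gt0 ?invr_gt0.
have lam0 i : 0 < lam i.
  have : Spec (diag_conj U mu) (of_real K (lam i)) by rewrite lam_spec; exists i.
  by case/(Spec_diag_conj UU) => k <-.
(* Each [mu_i] is some [lam m], so its square root is an interpolation node. *)
have mu_lam i : exists m, mu 0 i = lam m.
  have : Spec (diag_conj U mu) (of_real K (mu 0 i)).
    by apply/(Spec_diag_conj UU); exists i.
  by rewrite lam_spec => -[m _ /of_real_inj <-]; exists m.
(* Since the [lam i] are positive and distinct, the interpolation nodes are distinct. *)
have sqrt_lam_inj : injective (fun i => Num.sqrt (lam i)).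
  by move=> i j /eqP; rewrite eqr_sqrt ?ltW // => /eqP/lam_inj.
have interp i :
    \sum_(k < r) dcoef f lam k * Num.sqrt (mu 0 i) ^+ k = f (Num.sqrt (mu 0 i)).
  by have [m ->] := mu_lam i; exact: dcoef_interpolation.
have powE (k : nat) : matpow (diag_conj U mu) (k%:R / 2) =
    diag_conj U (\row_i Num.sqrt (mu 0 i) ^+ k).
  rewrite matpow_diag_conj //; congr diag_conj.
  by apply/rowP => i; rewrite mxE [RHS]mxE powR_half_nat // ltW.
split.
  (* The exponent 1/2 is the case [k = 1], up to conversion. *)
  rewrite (powE 1) matfun_diag_conj //.
  under eq_bigr do rewrite powE scale_diag_conj //.
  rewrite diag_conj_sum //; congr diag_conj; apply/rowP => i.
  rewrite mxE [X in f X]mxE expr1 -interp summxE.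
  by apply: eq_bigr => k _; rewrite !mxE.
(* The geometric mean of [A^-1] and [B] has diagonal entries [sqrt (a_i^-1 b_i)], the square roots
   of [mu], so [interp] applies again. *)
rewrite /altmean inv_mat_diag_conj // geomean_diag_conj //; last first.
  by move=> i; rewrite mxE invr_gt0.
rewrite matfun_diag_conj // !diag_conjM //.
under eq_bigr do under eq_bigr do
  rewrite powE diag_conjM // scale_diag_conj //.
under eq_bigr do rewrite diag_conj_sum //.
rewrite diag_conj_sum //; congr diag_conj; apply/rowP => i.
have muE : Num.sqrt ((a 0 i)^-1 * b 0 i) = Num.sqrt (mu 0 i).
  by rewrite mxE.
(* [f (sqrt mu_i)] occurs on both sides of [a_i]; expanding both copies gives the double sum. *)
rewrite !mxE muE -interp summxE mulrAC mulr_suml mulr_suml.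
apply: eq_bigr => k _; rewrite summxE mulr_sumr mulr_suml.
apply: eq_bigr => j _; rewrite [RHS]mxE [in RHS]mxE [in RHS]mxE exprD.
by ring.
Qed.
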